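(* There exist Turing functionals $\Phi$ and $\Psi$ such that $\lambda_\Phi=\lambda_\Psi$ and yet $\Phi(\mathsf{MLR})\neq\Psi(\mathsf{MLR})$.
   Context: $2^\omega$ is Cantor space, $2^{<\omega}$ the set of finite binary strings, $\preceq$ the prefix order; $\lambda$ is the uniform measure. A Turing functional $\Phi$ is a c.e. set of pairs $(\sigma,\tau)$ of strings such that whenever $(\sigma,\tau),(\sigma',\tau')\in\Phi$ and $\sigma\preceq\sigma'$, $\tau,\tau'$ are comparable. For $X\in2^\omega$, $\Phi^X$ is the maximal finite or infinite sequence extending every $\tau$ with $(\sigma,\tau)\in\Phi$ for some $\sigma\preceq X$; $\mathrm{dom}(\Phi)=\{X:\Phi^X\text{ infinite}\}$ and $\Phi(X)=\Phi^X$ for $X\in\mathrm{dom}(\Phi)$; for $A\subseteq2^\omega$, $\Phi(A)=\{\Phi(X):X\in A\cap\mathrm{dom}(\Phi)\}$. The induced semi-measure is $\lambda_\Phi(\sigma)=\lambda(\{X:\Phi^X\succeq\sigma\})$ for $\sigma\in2^{<\omega}$. $\mathsf{MLR}$ is the set of Martin-Löf random sequences for $\lambda$. *)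

(* Defs.v *)
From HB Require Import structures.
From mathcomp Require Import all_boot all_order all_algebra.
From mathcomp Require Import all_classical all_reals ereal esum.
From mathcomp Require Import Rstruct.
From Stdlib Require List.

Set Implicit Arguments.
Unset Strict Implicit.
Unset Printing Implicit Defensive.

Import Order.TTheory GRing.Theory Num.Theory.
Local Open Scope classical_set_scope.
Local Open Scope ring_scope.

Definition cantor : Type := (nat -> bool)%type.
Definition bstring := seq bool.

Definition sprefix (s : bstring) (X : cantor) : Prop :=
  forall i, (i < size s)%N -> nth false s i = X i.

Definition cyl (s : bstring) : set cantor := [set X | sprefix s X].

(* The uniform (Lebesgue) measure lambda on Cantor space, as the outer  *)
(* measure given by covers with cylinders: lambda(A) =                  *)
(*   inf { sum_{s in S} 2^{-|s|} : A subset of the union of [s], s in S }*)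
(* (it coincides with the uniform measure on all Borel sets).          *)

Definition Rr := Rdefinitions.R.

Definition weight (s : bstring) : \bar Rr := ((2%:R : Rr) ^- size s)%:E.

Definition lambda (A : set cantor) : \bar Rr :=
  ereal_inf [set (\esum_(s in S) weight s)%E | S in
     [set S : set bstring | A `<=` \bigcup_(s in S) cyl s]].

Inductive prf : Type :=
| PZero : prf
| PSucc : prf
| PProj : nat -> prf
| PComp : prf -> list prf -> prf
| PRec  : prf -> prf -> prf
| PMu   : prf -> prf.

Inductive prf_eval : prf -> seq nat -> nat -> Prop :=
| ev_zero xs : prf_eval PZero xs 0
| ev_succ xs : prf_eval PSucc xs (nth 0 xs 0).+1
| ev_proj i xs : prf_eval (PProj i) xs (nth 0 xs i)
| ev_comp f gs xs ys z :
    List.Forall2 (fun g y => prf_eval g xs y) gs ys ->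
    prf_eval f ys z -> prf_eval (PComp f gs) xs z
| ev_rec0 f g xs y : prf_eval f xs y -> prf_eval (PRec f g) (0 :: xs) y
| ev_recS f g n xs r y :
    prf_eval (PRec f g) (n :: xs) r -> prf_eval g (n :: r :: xs) y ->
    prf_eval (PRec f g) (n.+1 :: xs) y
| ev_mu f xs n :
    prf_eval f (n :: xs) 0 ->
    (forall m, (m < n)%N -> exists k, (0 < k)%N /\ prf_eval f (m :: xs) k) ->
    prf_eval (PMu f) xs n.

Definition ce_nat (A : set nat) : Prop :=
  exists c : prf, forall n, A n <-> exists y, prf_eval c [:: n] y.

(* Computable bijective codings: strings <-> positive naturals (binary of 1s),
   pairs via n,m |-> 2^n (2m+1) - 1 *)
Definition code_str (s : bstring) : nat := foldl (fun (n : nat) (b : bool) => (n.*2 + nat_of_bool b)%N) 1%N s.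
Definition code_pair (n m : nat) : nat := (2 ^ n * (m.*2.+1)).-1%N.

Definition ce_pairs (P : set (bstring * bstring)) : Prop :=
  ce_nat [set k | exists s t, P (s, t) /\ k = code_pair (code_str s) (code_str t)].

Definition ce_nat_str (P : set (nat * bstring)) : Prop :=
  ce_nat [set k | exists n s, P (n, s) /\ k = code_pair n (code_str s)].

Definition comparable (t t' : bstring) : bool := prefix t t' || prefix t' t.

Definition turing_functional (Phi : set (bstring * bstring)) : Prop :=
  ce_pairs Phi /\
  forall s t s' t', Phi (s, t) -> Phi (s', t') -> prefix s s' -> comparable t t'.

(* Phi^X extends the finite string u  (Phi^X is the union of all t with
   (s,t) in Phi, s a prefix of X) *)
Definition out_ext (Phi : set (bstring * bstring)) (X : cantor) (u : bstring) : Prop :=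
  exists s t, Phi (s, t) /\ sprefix s X /\ prefix u t.

Definition fdom (Phi : set (bstring * bstring)) : set cantor :=
  [set X | forall n, exists s t, Phi (s, t) /\ sprefix s X /\ (n <= size t)%N].

(* Phi(A) = { Phi(X) : X in A /\ X in dom(Phi) }, where Phi(X) = Phi^X is the
   (unique) infinite sequence extending every t with (s,t) in Phi, s prefix of X *)
Definition fimage (Phi : set (bstring * bstring)) (A : set cantor) : set cantor :=
  [set Y | exists X, A X /\ fdom Phi X /\
     (forall s t, Phi (s, t) -> sprefix s X -> sprefix t Y)].

Definition lambda_F (Phi : set (bstring * bstring)) (u : bstring) : \bar Rr :=
  lambda [set X | out_ext Phi X u].

Definition gen_open (W : set bstring) : set cantor := \bigcup_(s in W) cyl s.

Definition ML_test (U : set (nat * bstring)) : Prop :=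
  ce_nat_str U /\
  forall n, (lambda (gen_open [set s | U (n, s)]) <= ((2%:R : Rr) ^- n)%:E)%E.

Definition MLR : set cantor :=
  [set X | forall U, ML_test U -> ~ (forall n, gen_open [set s | U (n, s)] X)].

(* Main.v *)
Require Import Defs.
From mathcomp Require Import all_boot all_order all_algebra all_classical.
From mathcomp Require Import all_reals ereal esum Rstruct.
From mathcomp Require Import zify.
From Stdlib Require List.

Set Implicit Arguments.
Unset Strict Implicit.
Unset Printing Implicit Defensive.
Import Order.TTheory GRing.Theory Num.Theory.

(** The measures of the sets [{Z : Phi^Z extends 0^n}] are only left-c.e., so they
do not reveal where these sets lie. Let [X] be the leftmost path avoiding a
universal Martin-Loef test: it is random and the limit of computable strings
[x_t] of length [t] whose restrictions to [n] bits never move to the left. On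
reading a string of length [n], [Phi] outputs [0^n] if the string lies,
lexicographically, between [x_n] and some [x_t] restricted to [n] bits; [Psi]
does so for the equally many strings at the left end. Both sets of strings
shrink to a single path, which is [X] for [Phi], but [0^omega], which is not
random, for [Psi]. *)

(** * Functions computed by prf programs *)

(** A random path is not computable, so no functional can simply recognise its prefixes. What
    remains enumerable is the relation of lying to the left of it, because the approximations move
    in one direction only; this is why the path has to be the lexicographically least one. The left
    end [x_n] is fixed by the length [n]; without it every sequence to the left of the path would
    stay in the domain of [Phi]. The same monotonicity makes the accepted strings nested:
    restrictions of accepted strings are accepted. Hence the measure at [0^n] is the number of
    accepted strings of length [n] divided by [2^n], and it survives the translation of the interval
    by the computable amount [x_n], whereas the limit path does not. The path exists because program
    [e] contributes only its component [e+1], cut off at measure [2^-(e+1)]: finitely many such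
    contributions add up to less than 1, so at every length some string is left. *)

Definition cfun (F : (nat -> nat) -> nat) : Prop :=
  exists k c, forall r, prf_eval c (mkseq r k) (F r).

Definition cpred (P : (nat -> nat) -> bool) : Prop :=
  cfun (fun r => nat_of_bool (P r)).

(** Induction hypotheses are also needed for the evaluations that [ev_comp] nests in [Forall2] and
    [ev_mu] under an existential; hence the explicit fixpoint. *)
Lemma prf_eval_ind' (P : prf -> seq nat -> nat -> Prop) :
  (forall xs, P PZero xs 0) ->
  (forall xs, P PSucc xs (nth 0 xs 0).+1) ->
  (forall i xs, P (PProj i) xs (nth 0 xs i)) ->
  (forall f gs xs ys z, List.Forall2 (fun g y => P g xs y) gs ys ->
     P f ys z -> P (PComp f gs) xs z) ->
  (forall f g xs y, P f xs y -> P (PRec f g) (0 :: xs) y) ->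
  (forall f g n xs r y, P (PRec f g) (n :: xs) r -> P g (n :: r :: xs) y ->
     P (PRec f g) (n.+1 :: xs) y) ->
  (forall f xs n, P f (n :: xs) 0 ->
     (forall m, m < n -> exists k, 0 < k /\ P f (m :: xs) k) ->
     P (PMu f) xs n) ->
  forall c xs y, prf_eval c xs y -> P c xs y.
Proof.
move=> P0 PS Pp Pc Pr0 PrS Pm; fix IH 4 => c xs y.
case=> {c xs y} [xs|xs|i xs|f gs xs ys z Egs Ef|f g xs y Ef|f g n xs r y Er Eg|f xs n E0 Em].
- exact: P0.
- exact: PS.
- exact: Pp.
- apply: Pc (IH _ _ _ Ef); elim: Egs => [|g y gs' ys' Eg _ IHgs]; first by constructor.
  by constructor; [exact: IH | exact: IHgs].
- exact/Pr0/IH.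
- exact: PrS (IH _ _ _ Er) (IH _ _ _ Eg).
- by apply: Pm (IH _ _ _ E0) _ => m /Em[k [k0 Ek]]; exists k; split=> //; exact: IH.
Qed.

Lemma prf_eval_fun c xs y z : prf_eval c xs y -> prf_eval c xs z -> y = z.
Proof.
move=> Ey; elim/prf_eval_ind': c xs y / Ey z.
- by move=> xs z Ez; inversion Ez.
- by move=> xs z Ez; inversion Ez.
- by move=> i xs z Ez; inversion Ez.
- move=> f gs xs ys z IHgs IHf z' Ez; inversion Ez as [| | |? ? ? ys' ? Egs Ef| | |]; subst.
  apply: IHf; suff -> : ys = ys' by [].
  clear - IHgs Egs; elim: IHgs ys' Egs => [|g y gs' ys' IHg _ IHgs] ys2 E2.
    by inversion E2.
  by inversion E2; subst; congr (_ :: _); [exact: IHg | exact: IHgs].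
- by move=> f g xs y IH z Ez; inversion Ez; subst; exact: IH.
- move=> f g n xs r y IHr IHg z Ez; inversion Ez as [| | | | |? ? ? ? r' ? Er Eg|]; subst.
  by apply: IHg; rewrite (IHr _ Er).
- move=> f xs n IH0 IHm z Ez; inversion Ez as [| | | | | |? ? ? E0 Em]; subst.
  (* Of two different results of [PMu], the smaller one would give [f] both the value zero and a
     positive value. *)
  case: (ltngtP n z) => // [/Em[k [k0 /IH0 k_eq]] | /IHm[k [k0 IHk]]].
    by rewrite -k_eq in k0.
  by rewrite (IHk _ E0) in k0.
Qed.

Lemma mkseq_cons (T : Type) (f : nat -> T) k :
  mkseq f k.+1 = f 0 :: mkseq (fun j => f j.+1) k.
Proof. by rewrite /mkseq /= (iotaDl 1 0 k) -map_comp. Qed.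

Lemma Forall2_mkseq (S T : Type) (R : S -> T -> Prop) f g k :
  (forall i, i < k -> R (f i) (g i)) -> List.Forall2 R (mkseq f k) (mkseq g k).
Proof.
elim: k f g => [|k IHk] f g Rfg; first by constructor.
by rewrite !mkseq_cons; constructor; [exact: Rfg | apply: IHk => i lt_ik; exact: Rfg].
Qed.

Lemma eval_projs r k m : m <= k ->
  List.Forall2 (fun g y => prf_eval g (mkseq r k) y) (mkseq PProj m) (mkseq r m).
Proof.
move=> le_mk; apply: Forall2_mkseq => i lt_im.
by rewrite -(nth_mkseq 0 r (leq_trans lt_im le_mk)); constructor.
Qed.

(** Projections discard surplus arguments, so programs of different arities can be brought to a
    common one. *)
Lemma cfun_widen F : cfun F ->
  exists k0, forall k, k0 <= k -> exists c, forall r, prf_eval c (mkseq r k) (F r).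
Proof.
case=> m [c Fc]; exists m => k le_mk; exists (PComp c (mkseq PProj m)) => r.
exact: ev_comp (eval_projs r le_mk) (Fc r).
Qed.

(** Past the end of a list [PProj] and [nth 0] both read [0], so one program serves lists of every
    length. *)
Lemma cfun_code F : cfun F -> exists c, forall xs, prf_eval c xs (F (nth 0 xs)).
Proof.
case=> m [c Fc]; exists (PComp c (mkseq PProj m)) => xs.
by apply: ev_comp (Fc _); apply: Forall2_mkseq => i _; constructor.
Qed.

Lemma cfun_ext F G : (forall r, F r = G r) -> cfun F -> cfun G.
Proof. by move=> eqFG [k [c Fc]]; exists k, c => r; rewrite -eqFG. Qed.

Lemma cpred_ext (P Q : (nat -> nat) -> bool) : (forall r, P r = Q r) -> cpred P -> cpred Q.
Proof. by move=> eqPQ; apply: cfun_ext => r; rewrite eqPQ. Qed.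

Lemma cfun_subst F (G : nat -> (nat -> nat) -> nat) :
  cfun F -> (forall i, cfun (G i)) -> cfun (fun r => F (fun i => G i r)).
Proof.
move=> [m [c Fc]] cG.
have [k0 /(_ k0 (leqnn _)) [gs Ggs]] : exists k0, forall k, k0 <= k -> exists gs,
    forall r, List.Forall2 (fun g y => prf_eval g (mkseq r k) y) gs
                (mkseq (fun i => G i r) m).
  elim: m {c Fc} => [|m [k1 IH1]]; first by exists 0 => k _; exists [::] => r.
  have [k2 IH2] := cfun_widen (cG m).
  exists (maxn k1 k2) => k; rewrite geq_max => /andP[/IH1[gs Ggs] /IH2[g Gg]].
  exists (rcons gs g) => r; rewrite mkseqS -!cats1.
  by apply: List.Forall2_app; [exact: Ggs | constructor].
by exists k0, (PComp c gs) => r; exact: ev_comp (Ggs r) (Fc _).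
Qed.

Lemma cfun_var i : cfun (fun r => r i).
Proof.
by exists i.+1, (PProj i) => r; rewrite -[X in prf_eval _ _ X](nth_mkseq 0 r (ltnSn i)); constructor.
Qed.

Lemma cfunS F : cfun F -> cfun (fun r => (F r).+1).
Proof.
case=> k [c Fc]; exists k, (PComp PSucc [:: c]) => r.
by apply: (ev_comp (ys := [:: F r])); [constructor | exact: (ev_succ [:: F r])].
Qed.

Lemma cfun_const n : cfun (fun=> n).
Proof. by elim: n => [|n /cfunS//]; exists 0, PZero => r; constructor. Qed.

(** Binding shifts the environment: [r 0] is the counter, [r 1] the previous value, and the
    parameters follow, in the order in which [ev_recS] passes them. *)
Lemma cfun_rec A B N :
  cfun A -> cfun (fun r => B (r 0) (r 1) (fun j => r j.+2)) -> cfun N ->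
  cfun (fun r => nat_rect (fun=> nat) (A r) (fun n y => B n y r) (N r)).
Proof.
move=> /cfun_widen[kA cA] /cfun_widen[kB cB] /cfun_widen[kN cN].
pose k := maxn kA (maxn kB kN).
have [a Aa] := cA k (leq_maxl _ _).
have [|b Bb] := cB k.+2; first by rewrite /k; lia.
have [|n Nn] := cN k; first by rewrite /k; lia.
exists k, (PComp (PRec a b) (n :: mkseq PProj k)) => r.
apply: (ev_comp (ys := N r :: mkseq r k)).
  by constructor; [exact: Nn | exact: eval_projs].
elim: (N r) => [|m IHm] /=; first exact: ev_rec0.
apply: ev_recS IHm _; set y := nat_rect _ _ _ _.
have := Bb (fun j => if j is j'.+1 then if j' is i.+1 then r i else y else m).
by rewrite !mkseq_cons.
Qed.

Lemma cfun_app1 f A : cfun (fun r => f (r 0)) -> cfun A -> cfun (fun r => f (A r)).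
Proof. by move=> cf cA; exact: (cfun_subst (G := fun=> A) cf). Qed.

Lemma cfun_app2 f A B : cfun (fun r => f (r 0) (r 1)) -> cfun A -> cfun B ->
  cfun (fun r => f (A r) (B r)).
Proof.
move=> cf cA cB; pose G i := if i is 0 then A else B.
by apply: (cfun_subst (G := G) cf); case.
Qed.

Lemma cfun_app3 f A B C : cfun (fun r => f (r 0) (r 1) (r 2)) ->
  cfun A -> cfun B -> cfun C -> cfun (fun r => f (A r) (B r) (C r)).
Proof.
move=> cf cA cB cC.
pose G i := match i with 0 => A | 1 => B | _ => C end.
by apply: (cfun_subst (G := G) cf); case=> [|[]].
Qed.

Lemma cfunD A B : cfun A -> cfun B -> cfun (fun r => A r + B r).
Proof.
move=> cA cB; apply: cfun_ext (cfun_rec (B := fun _ y _ => y.+1) cB _ cA).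
  by move=> r; elim: (A r) => //= n ->.
exact/cfunS/cfun_var.
Qed.

Lemma cfunM A B : cfun A -> cfun B -> cfun (fun r => A r * B r).
Proof.
move=> cA cB.
apply: cfun_ext (cfun_rec (B := fun _ y r => B r + y) (cfun_const 0) _ cA).
  by move=> r; elim: (A r) => //= n ->; rewrite mulSn.
apply: cfunD (cfun_var _).
exact: (cfun_subst (G := fun i r => r i.+2) cB) (fun i => cfun_var _).
Qed.

Lemma cfun_pred A : cfun A -> cfun (fun r => (A r).-1).
Proof.
move=> cA.
apply: cfun_ext (cfun_rec (B := fun n _ _ => n) (cfun_const 0) _ cA).
  by move=> r; case: (A r).
exact: cfun_var.
Qed.

Lemma cfunB A B : cfun A -> cfun B -> cfun (fun r => A r - B r).
Proof.
move=> cA cB; apply: cfun_ext (cfun_rec (B := fun _ y _ => y.-1) cA _ cB).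
  by move=> r; elim: (B r) => [|n /= ->]; rewrite ?subn0 ?subnS.
exact/cfun_pred/cfun_var.
Qed.

Lemma cfunX A B : cfun A -> cfun B -> cfun (fun r => A r ^ B r).
Proof.
move=> cA cB.
apply: cfun_ext (cfun_rec (B := fun _ y r => A r * y) (cfun_const 1) _ cB).
  by move=> r; elim: (B r) => //= n ->; rewrite expnS.
apply: cfunM (cfun_var _).
exact: (cfun_subst (G := fun i r => r i.+2) cA) (fun i => cfun_var _).
Qed.

Lemma cfun_bool P : cpred P -> cfun (fun r => nat_of_bool (P r)).
Proof. by []. Qed.

Lemma cpred_leq A B : cfun A -> cfun B -> cpred (fun r => A r <= B r).
Proof.
move=> cA cB.
apply: cfun_ext (cfunB (cfun_const 1) (cfunB cA cB)).
by move=> r; rewrite /leq; case: (A r - B r).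
Qed.

Lemma cpredN P : cpred P -> cpred (fun r => ~~ P r).
Proof.
move=> cP; apply: cfun_ext (cfunB (cfun_const 1) cP).
by move=> r; case: (P r).
Qed.

Lemma cpredI P Q : cpred P -> cpred Q -> cpred (fun r => P r && Q r).
Proof. by move=> cP cQ; apply: cfun_ext (cfunM cP cQ) => r; rewrite mulnb. Qed.

Lemma cpredU P Q : cpred P -> cpred Q -> cpred (fun r => P r || Q r).
Proof.
move=> cP cQ; apply: cpred_ext (cpredN (cpredI (cpredN cP) (cpredN cQ))) => r.
by rewrite negb_and !negbK.
Qed.

Lemma cpred_eq A B : cfun A -> cfun B -> cpred (fun r => A r == B r).
Proof.
move=> cA cB; apply: cpred_ext (cpredI (cpred_leq cA cB) (cpred_leq cB cA)) => r.
by rewrite eqn_leq.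
Qed.

Definition bsum n (f : nat -> nat) := \sum_(i < n) f i.
Definition bex n (P : nat -> bool) := [exists i : 'I_n, P i].
Definition ball n (P : nat -> bool) := [forall i : 'I_n, P i].

Lemma bexP n (P : nat -> bool) : reflect (exists2 i, i < n & P i) (bex n P).
Proof.
apply: (iffP existsP) => [[i Pi] | [i lt_in Pi]]; first by exists i.
by exists (Ordinal lt_in).
Qed.

Lemma ballP n (P : nat -> bool) : reflect (forall i, i < n -> P i) (ball n P).
Proof.
by apply: (iffP forallP) => [allP i lt_in | allP i]; [exact: (allP (Ordinal _)) | exact: allP].
Qed.

Lemma cfun_bsum N f :
  cfun N -> cfun (fun r => f (r 0) (fun j => r j.+1)) ->
  cfun (fun r => bsum (N r) (fun i => f i r)).
Proof.
move=> cN cf.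
apply: cfun_ext (cfun_rec (B := fun n y r => y + f n r) (cfun_const 0) _ cN).
  rewrite /bsum => r; elim: (N r) => [|n /= ->]; first by rewrite big_ord0.
  by rewrite big_ord_recr.
apply: cfunD (cfun_var _) _.
exact: (cfun_subst (G := fun i r => r (if i is j.+1 then j.+2 else 0)) cf)
  (fun i => cfun_var _).
Qed.

Lemma cpred_bex N (P : nat -> (nat -> nat) -> bool) :
  cfun N -> cpred (fun r => P (r 0) (fun j => r j.+1)) ->
  cpred (fun r => bex (N r) (fun i => P i r)).
Proof.
move=> cN cP.
apply: cpred_ext (cpredN (cpred_eq (cfun_bsum (f := fun i r => P i r) cN cP) (cfun_const 0))) => r.
rewrite /bsum sum_nat_eq0 negb_forall /bex; apply: eq_existsb => i /=.
by case: (P i r).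
Qed.

Lemma cpred_ball N (P : nat -> (nat -> nat) -> bool) :
  cfun N -> cpred (fun r => P (r 0) (fun j => r j.+1)) ->
  cpred (fun r => ball (N r) (fun i => P i r)).
Proof.
move=> cN cP.
apply: cpred_ext (cpredN (cpred_bex (P := fun i r => ~~ P i r) cN (cpredN cP))) => r.
rewrite /bex /ball negb_exists; apply: eq_forallb => i /=.
by rewrite negbK.
Qed.

(** Presents a number as a count: quotients, exponents, lengths and least elements become computable
    by being counted with bounded sums. *)
Lemma bsum_ltn n q : bsum n (fun i => i < q) = minn n q.
Proof.
rewrite /bsum; elim: n => [|n IHn]; first by rewrite big_ord0 min0n.
by rewrite big_ord_recr /= IHn; case: ltnP => /=; lia.
Qed.

Lemma cfun_div2X A B : cfun A -> cfun B -> cfun (fun r => A r %/ 2 ^ B r).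
Proof.
move=> cA cB.
have sh F : cfun F -> cfun (fun r => F (fun j => r j.+1)).
  by move=> cF; exact: (cfun_subst (G := fun i r => r i.+1) cF) (fun i => cfun_var _).
(* The quotient counts the positive multiples of [2 ^ B r] up to [A r]. *)
apply: cfun_ext (cfun_bsum (f := fun i r => (i.+1 * 2 ^ B r <= A r)) cA _).
  move=> r; rewrite -[RHS](minn_idPr (leq_div (A r) (2 ^ B r))) -bsum_ltn.
  by apply: eq_bigr => i _; rewrite -leq_divRL ?expn_gt0.
apply: cpred_leq (sh _ cA); apply: cfunM.
  exact/cfunS/cfun_var.
exact: cfunX (cfun_const 2) (sh _ cB).
Qed.

Lemma cpred_odd A : cfun A -> cpred (fun r => odd (A r)).
Proof.
move=> cA; apply: cfun_ext (cfunB cA (cfunM (cfun_const 2) (cfun_div2X cA (cfun_const 1)))).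
by move=> r; rewrite expn1 divn2 mul2n -{1}(odd_double_half (A r)) addnK.
Qed.

(** A hook of [cf], rebound below as further functions are shown computable. *)
Ltac cf_app := fail.

Ltac cf_step :=
  cbv beta; lazymatch goal with
  | |- cpred (fun _ => bex _ _) => apply: cpred_bex
  | |- cpred (fun _ => ball _ _) => apply: cpred_ball
  | |- cpred (fun _ => ~~ _) => apply: cpredN
  | |- cpred (fun _ => _ && _) => apply: cpredI
  | |- cpred (fun _ => _ || _) => apply: cpredU
  | |- cpred (fun _ => _ <= _) => apply: cpred_leq
  | |- cpred (fun _ => _ == _) => apply: cpred_eq
  | |- cpred (fun _ => odd _) => apply: cpred_odd
  | |- cfun (fun _ => bsum _ _) => apply: cfun_bsum
  | |- cfun (fun _ => nat_of_bool _) => apply: cfun_bool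
  | |- cfun (fun _ => _ + _) => apply: cfunD
  | |- cfun (fun _ => _ * _) => apply: cfunM
  | |- cfun (fun _ => _ - _) => apply: cfunB
  | |- cfun (fun _ => _ ^ _) => apply: cfunX
  | |- cfun (fun _ => _ %/ 2 ^ _) => apply: cfun_div2X
  | |- cfun (fun _ => _.-1) => apply: cfun_pred
  | _ => first [exact: cfun_var | exact: cfun_const | cf_app | apply: cfunS]
  end.

Ltac cf := repeat cf_step.


(** [PMu] searches for a zero, so it is run on the negation of [R]. The least witness is taken
    because [ev_mu] demands positive values before the result. *)
Lemma ce_nat_ex (R : nat -> nat -> bool) :
  cpred (fun r => R (r 0) (r 1)) -> ce_nat [set k | exists w, R w k].
Proof.
move=> /cpredN/cfun_code[c cR]; exists (PMu c) => k; split.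
  case=> w0 Rw0; exists (ex_minn (ex_intro (R^~ k) w0 Rw0)).
  case: ex_minnP => w Rw min_w; apply: ev_mu; first by have := cR [:: w; k]; rewrite /= Rw.
  move=> m lt_mw; exists 1; split=> //.
  by have := cR [:: m; k]; rewrite /= (contraNF (min_w m)) // -ltnNge.
case=> w Ew; exists w; inversion Ew as [| | | | | |? ? ? E0 _]; subst.
by apply: contraT => /negbTE nRw; have := prf_eval_fun E0 (cR [:: w; k]); rewrite /= nRw.
Qed.

(** * A universal enumeration of the c.e. sets *)

Arguments CodeSeq.code : simpl never.
Arguments CodeSeq.decode : simpl never.

(** List operations on the codes of [CodeSeq]: [0] is the empty list; otherwise the exponent of 2 is
    the head and the odd factor determines the tail. Every number codes a list. *)
Definition consL x l := 2 ^ x * (l * 2).+1.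
Definition headL l := nth 0 (CodeSeq.decode l) 0.
Definition tailL l := CodeSeq.code (behead (CodeSeq.decode l)).
Definition dropL l i := nat_rect (fun=> nat) l (fun _ y => tailL y) i.
Definition nthL l i := nth 0 (CodeSeq.decode l) i.
Definition sizeL l := size (CodeSeq.decode l).

Arguments consL : simpl never.
Arguments headL : simpl never.
Arguments tailL : simpl never.
Arguments nthL : simpl never.
Arguments sizeL : simpl never.

Lemma consLE x s : consL x (CodeSeq.code s) = CodeSeq.code (x :: s).
Proof. by rewrite /consL muln2. Qed.

(** For nonzero [l] the head is the number of powers [2 ^ i.+1] dividing [l]; for [l = 0] the sum is
    empty. *)
Lemma headLE l :
  headL l = bsum l (fun i => (l %/ 2 ^ i.+1) * 2 ^ i.+1 == l).
Proof.
rewrite /headL -{2 3 4}(CodeSeq.decodeK l); case: (CodeSeq.decode l) => [|n s] /=.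
  by rewrite /bsum big_ord0.
set l' := CodeSeq.code (n :: s).
have l'E : l' = 2 ^ n * (CodeSeq.code s).*2.+1 by [].
have lt_nl : n < l'.
  by rewrite l'E -[n.+1]muln1 leq_mul // ltn_expl.
rewrite -[LHS](minn_idPr (ltnW lt_nl)) -bsum_ltn; apply: eq_bigr => -[i /= _] _.
rewrite -dvdn_eq l'E; case: (ltnP i n) => [lt_in|le_ni].
  by rewrite dvdn_mulr // dvdn_exp2l.
rewrite -(subnKC le_ni) -addnS expnD dvdn_pmul2l ?expn_gt0 // expnS.
case: dvdnP => // -[q]; lia.
Qed.

Lemma tailLE l : tailL l = l %/ 2 ^ headL l %/ 2 ^ 1.
Proof.
rewrite /tailL /headL -{2}(CodeSeq.decodeK l); case: (CodeSeq.decode l) => [|n s] /=.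
  by rewrite !div0n.
rewrite [in RHS]/CodeSeq.code /= -/(CodeSeq.code s) mulKn ?expn_gt0 // expn1.
by rewrite divn2 /= uphalf_double.
Qed.

Lemma dropLE l i : dropL l i = CodeSeq.code (drop i (CodeSeq.decode l)).
Proof.
elim: i => [|i IHi]; first by rewrite drop0 CodeSeq.decodeK.
rewrite /dropL /= -/(dropL l i) IHi /tailL CodeSeq.codeK; congr CodeSeq.code.
by rewrite -drop1 drop_drop.
Qed.

Lemma nthLE l i : nthL l i = headL (dropL l i).
Proof. by rewrite /headL dropLE CodeSeq.codeK nth_drop addn0. Qed.

Lemma size_decode l : sizeL l <= l.
Proof.
rewrite /sizeL -{2}(CodeSeq.decodeK l); elim: (CodeSeq.decode l) => //= n s IHs.
rewrite /CodeSeq.code /= -/(CodeSeq.code s); have := expn_gt0 2 n; nia.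
Qed.

Lemma sizeLE l : sizeL l = bsum l (fun i => ~~ (dropL l i == 0)).
Proof.
rewrite -[LHS](minn_idPr (size_decode l)) -bsum_ltn; apply: eq_bigr => i _.
have code_eq0 s : (CodeSeq.code s == 0) = (size s == 0).
  case: s => // n s; rewrite /CodeSeq.code /= -/(CodeSeq.code s).
  by rewrite muln_eq0 expn_eq0.
by rewrite dropLE code_eq0 size_drop subn_eq0 -ltnNge.
Qed.

Lemma cfun_headL : cfun (fun r => headL (r 0)).
Proof. by apply: (cfun_ext (fun r => esym (headLE (r 0)))); cf. Qed.

Ltac cf_app ::= first
  [ apply: (cfun_app1 cfun_headL) ].

Lemma cfun_tailL : cfun (fun r => tailL (r 0)).
Proof. by apply: (cfun_ext (fun r => esym (tailLE (r 0)))); cf. Qed.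

Lemma cfun_dropL : cfun (fun r => dropL (r 0) (r 1)).
Proof.
apply: cfun_rec (cfun_var 0) _ (cfun_var 1).
exact: (cfun_app1 cfun_tailL (cfun_var 1)).
Qed.

Ltac cf_app ::= first
  [ apply: (cfun_app1 cfun_headL) | apply: (cfun_app1 cfun_tailL)
  | apply: (cfun_app2 cfun_dropL) ].

Lemma cfun_nthL : cfun (fun r => nthL (r 0) (r 1)).
Proof. by apply: (cfun_ext (fun r => esym (nthLE (r 0) (r 1)))); cf. Qed.

Lemma cfun_sizeL : cfun (fun r => sizeL (r 0)).
Proof. by apply: (cfun_ext (fun r => esym (sizeLE (r 0)))); cf. Qed.

Lemma cfun_consL : cfun (fun r => consL (r 0) (r 1)).
Proof. by rewrite /consL; cf. Qed.

Ltac cf_app ::= first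
  [ apply: (cfun_app1 cfun_headL) | apply: (cfun_app1 cfun_tailL)
  | apply: (cfun_app1 cfun_sizeL) | apply: (cfun_app2 cfun_nthL)
  | apply: (cfun_app2 cfun_consL) ].

(* [b] is a bit set of judgments: program code, code of the argument list, value. *)
Definition recorded b e xs y := odd (b %/ 2 ^ consL e (consL xs (consL y 0))).

(* One forward step: the judgment follows from those in [b] by a rule of
   [prf_eval], the existential witnesses being bounded by [t]. *)
Definition just t b e xs y : bool :=
  [|| (nthL e 0 == 0) && (y == 0),
      (nthL e 0 == 1) && (y == (headL xs).+1),
      (nthL e 0 == 2) && (y == nthL xs (nthL e 1)),
      (nthL e 0 == 3) && bex t (fun ys =>
        (recorded b (nthL e 1) ys y && (sizeL ys == sizeL (nthL e 2))) &&
        ball (sizeL ys) (fun i => recorded b (nthL (nthL e 2) i) xs (nthL ys i))),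
      ((nthL e 0 == 4) && (xs == consL 0 (tailL xs))) &&
        recorded b (nthL e 1) (tailL xs) y,
      ((nthL e 0 == 4) && (xs == consL (headL xs).-1.+1 (tailL xs))) &&
        bex t (fun r => recorded b e (consL (headL xs).-1 (tailL xs)) r &&
          recorded b (nthL e 2) (consL (headL xs).-1 (consL r (tailL xs))) y)
    | ((nthL e 0 == 5) && recorded b (nthL e 1) (consL y xs) 0) &&
        ball y (fun m => bex t (fun k => recorded b (nthL e 1) (consL m xs) k.+1))].

(** Sets of judgments are single numbers, so the whole enumeration is one primitive recursion. Each
    stage is recomputed from the preceding one; [judged_mono] shows that nothing is lost. *)
Definition stage t := nat_rect (fun=> nat) 0 (fun t b =>
  bsum t (fun j => just t b (nthL j 0) (nthL j 1) (nthL j 2) * 2 ^ j)) t.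

Lemma cfun_stage : cfun (fun r => stage (r 0)).
Proof.
apply: (cfun_rec (B := fun t b _ => bsum t (fun j =>
  just t b (nthL j 0) (nthL j 1) (nthL j 2) * 2 ^ j)) (cfun_const 0) _ (cfun_var 0)).
have cj : cfun (fun r => just (r 0) (r 1) (r 2) (r 3) (r 4)).
  by rewrite /just /recorded; cf.
cf.
apply: (cfun_subst (G := fun i r => match i with 0 => r 1 | 1 => r 2 |
   2 => nthL (r 0) 0 | 3 => nthL (r 0) 1 | _ => nthL (r 0) 2 end) cj).
by move=> [|[|[|[|i]]]]; cf.
Qed.

Lemma odd_bsum n (f : nat -> bool) i :
  odd (bsum n (fun j => f j * 2 ^ j) %/ 2 ^ i) = (i < n) && f i.
Proof.
elim: i n f => [|i IHi] [|n] f; rewrite /bsum ?big_ord0 ?div0n // big_ord_recl.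
  rewrite divn1 muln1 oddD oddb; under eq_bigr do rewrite expnS mulnCA.
  by rewrite -big_distrr /= oddM addbF.
under eq_bigr do rewrite expnS mulnCA.
rewrite -big_distrr /= muln1 expnS divnMA addnC mulnC divnMDl //.
by rewrite (@divn_small (f 0)) ?addn0 ?(IHi n (fun j => f j.+1)) //; case: (f 0).
Qed.

Definition judged t := recorded (stage t).

Lemma nthL_code s i : nthL (CodeSeq.code s) i = nth 0 s i.
Proof. by rewrite /nthL CodeSeq.codeK. Qed.

Lemma sizeL_code s : sizeL (CodeSeq.code s) = size s.
Proof. by rewrite /sizeL CodeSeq.codeK. Qed.

Lemma headL_code s : headL (CodeSeq.code s) = nth 0 s 0.
Proof. by rewrite /headL CodeSeq.codeK. Qed.

Lemma tailL_code s : tailL (CodeSeq.code s) = CodeSeq.code (behead s).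
Proof. by rewrite /tailL CodeSeq.codeK. Qed.

Definition jcode e xs y := CodeSeq.code [:: e; xs; y].

Lemma judgedS t e xs y :
  judged t.+1 e xs y = (jcode e xs y < t) && just t (stage t) e xs y.
Proof.
rewrite /judged /recorded -[0]/(CodeSeq.code [::]) !consLE /= odd_bsum.
by rewrite !nthL_code.
Qed.

(** A list code exceeds its entries. Witnesses taken from recorded judgments thus meet the bound
    imposed in [just]. *)
Lemma judged_lt t e xs y : judged t e xs y -> [&& e < t, xs < t & y < t].
Proof.
case: t => [|t]; first by rewrite /judged /recorded div0n.
rewrite judgedS => /andP[lt_jt _].
have /= := CodeSeq.ltn_code [:: e; xs; y]; rewrite -/(jcode e xs y); lia.
Qed.

(** No rule uses recorded judgments negatively, and the stage bounds existential quantifiers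
    only. *)
Lemma just_mono t t' e xs y : t <= t' ->
  (forall e xs y, judged t e xs y -> judged t' e xs y) ->
  just t (stage t) e xs y -> just t' (stage t') e xs y.
Proof.
move=> le_tt' sub.
have {}sub e' xs' y' : recorded (stage t) e' xs' y' -> recorded (stage t') e' xs' y'.
  exact: sub.
rewrite /just => /or4P[->|->|->|/or4P[|||]]; rewrite ?orbT //.
- case/andP=> -> /bexP[ys lt_ys /andP[/andP[/sub H1 H2] /ballP H3]].
  apply/or4P/Or44/or4P/Or41/bexP; exists ys; first exact: leq_trans lt_ys _.
  by rewrite H1 H2; apply/ballP => i /H3/sub.
- by case/andP=> -> /sub->; apply/or4P/Or44/or4P/Or42.
- case/andP=> -> /bexP[r lt_r /andP[/sub H1 /sub H2]].
  apply/or4P/Or44/or4P/Or43/bexP; exists r; first exact: leq_trans lt_r _.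
  by rewrite H1.
- case/andP=> /andP[-> /sub->] /ballP H.
  apply/or4P/Or44/or4P/Or44/ballP => m /H/bexP[k lt_k /sub Hk].
  by apply/bexP; exists k => //; exact: leq_trans lt_k _.
Qed.

Lemma judged_mono t t' e xs y : t <= t' -> judged t e xs y -> judged t' e xs y.
Proof.
suff step u : forall e xs y, judged u e xs y -> judged u.+1 e xs y.
  by move/subnKC <-; elim: (t' - t) => [|n IHn]; rewrite ?addn0 ?addnS // => /IHn/step.
elim: u => [|u IHu] {}e {}xs {}y; first by rewrite /judged /recorded div0n.
rewrite !judgedS => /andP[lt_ju ju]; rewrite ltnS (ltnW lt_ju).
exact: just_mono (leqnSn u) IHu ju.
Qed.

Lemma just_judged t e xs y :
  just t (stage t) e xs y -> exists t', judged t' e xs y.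
Proof.
move=> jt; pose u := maxn t (jcode e xs y).+1; exists u.+1.
rewrite judgedS leq_maxr /=; apply: just_mono jt; first exact: leq_maxl.
by move=> *; apply: judged_mono; first exact: leq_maxl; eassumption.
Qed.

Lemma uniform_stage n (Q : nat -> nat -> Prop) :
  (forall m t t', t <= t' -> Q m t -> Q m t') ->
  (forall m, m < n -> exists t, Q m t) -> exists t, forall m, m < n -> Q m t.
Proof.
move=> monoQ; elim: n => [|n IHn] exQ; first by exists 0.
have [t Qt] := IHn (fun m lt_mn => exQ m (ltnW lt_mn)).
have [t' Qt'] := exQ n (ltnSn n).
exists (maxn t t') => m; rewrite ltnS leq_eqVlt => /predU1P[->|/Qt].
  exact: monoQ (leq_maxr _ _) Qt'.
exact/monoQ/leq_maxl.
Qed.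

(** The tags [0] to [5] are those that [just] tests. *)
Fixpoint pcode (c : prf) : nat :=
  match c with
  | PZero => CodeSeq.code [:: 0]
  | PSucc => CodeSeq.code [:: 1]
  | PProj i => CodeSeq.code [:: 2; i]
  | PComp f gs => CodeSeq.code [:: 3; pcode f; CodeSeq.code (map pcode gs)]
  | PRec f g => CodeSeq.code [:: 4; pcode f; pcode g]
  | PMu f => CodeSeq.code [:: 5; pcode f]
  end.

Lemma Forall2_nth (S T : Type) (x0 : S) (y0 : T) (R : S -> T -> Prop) s1 s2 :
  List.Forall2 R s1 s2 <->
  size s1 = size s2 /\ forall i, i < size s1 -> R (nth x0 s1 i) (nth y0 s2 i).
Proof.
split=> [|[]].
  elim=> // x y s1' s2' Rxy _ [eq_sz Rs]; split=> /=; first by rewrite eq_sz.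
  by case=> //= i /Rs.
elim: s1 s2 => [|x s1 IHs] [|y s2] //= [eq_sz] Rs; constructor; first exact: (Rs 0).
by apply: IHs => // i lt_i; exact: (Rs i.+1).
Qed.

(** Induction on the evaluation: all premises of the last rule are recorded at one late enough
    stage, and there [just] yields the conclusion. *)
Lemma judged_complete c xs y :
  prf_eval c xs y -> exists t, judged t (pcode c) (CodeSeq.code xs) y.
Proof.
move=> Ec; elim/prf_eval_ind': c xs y / Ec.
- by move=> xs; apply: (@just_judged 0); rewrite /just nthL_code.
- by move=> xs; apply: (@just_judged 0); apply/or4P/Or42; rewrite nthL_code headL_code /= eqxx.
- by move=> i xs; apply: (@just_judged 0); apply/or4P/Or43; rewrite !nthL_code /= eqxx.
- move=> f gs xs ys z /(Forall2_nth PZero 0)[eq_sz Hgs] [t Ht].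
  have [i t1 t2|t' Ht'] := uniform_stage (Q := fun i t => judged t
    (pcode (nth PZero gs i)) (CodeSeq.code xs) (nth 0 ys i)) _ Hgs.
    exact: judged_mono.
  pose u := maxn t (maxn t' (CodeSeq.code ys).+1).
  apply: (@just_judged u); apply/or4P/Or44/or4P/Or41; rewrite !nthL_code /=.
  apply/bexP; exists (CodeSeq.code ys); first by rewrite /u; lia.
  rewrite !sizeL_code size_map eq_sz eqxx andbT; apply/andP; split.
    by apply: judged_mono Ht; rewrite /u; lia.
  apply/ballP => i lt_i; rewrite -eq_sz in lt_i; rewrite !nthL_code (nth_map PZero) //.
  by apply: judged_mono (Ht' i lt_i); rewrite /u; lia.
- move=> f g xs y [t Ht]; apply: (@just_judged t).
  apply/or4P/Or44/or4P/Or42; rewrite !nthL_code tailL_code /= consLE eqxx.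
  exact: Ht.
- move=> f g n xs r y [t1 Ht1] [t2 Ht2]; pose u := maxn t1 t2.
  apply: (@just_judged u); apply/or4P/Or44/or4P/Or43.
  rewrite !nthL_code headL_code tailL_code /= !consLE eqxx /=.
  have Hr := judged_mono (leq_maxl t1 t2) Ht1; apply/bexP; exists r.
    by case/and3P: (judged_lt Hr).
  by apply/andP; split=> //; rewrite !consLE; exact: judged_mono (leq_maxr t1 t2) Ht2.
- move=> f xs n [t0 H0] Hm.
  have [m t t' le_tt'|m lt_mn|t Ht] :=
      @uniform_stage n (fun m t => exists k, 0 < k /\ judged t (pcode f) (CodeSeq.code (m :: xs)) k).
  + by case=> k [k0 /(judged_mono le_tt')]; exists k.
  + by have [k [k0 [t Ht]]] := Hm m lt_mn; exists t, k.
  pose u := maxn t0 t; apply: (@just_judged u); apply/or4P/Or44/or4P/Or44.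
  rewrite !nthL_code /= consLE; apply/andP; split.
    exact: judged_mono (leq_maxl _ _) H0.
  apply/ballP => m /Ht[[|k] [// _ /(judged_mono (leq_maxr t0 t)) Hk]].
  rewrite consLE; apply/bexP; exists k => //; case/and3P: (judged_lt Hk) => _ _; exact: ltnW.
Qed.

(** Induction on the stage, since a step uses only judgments of the preceding one; the tag of
    [pcode c] singles out the rules that can have been applied. *)
Lemma judged_sound t c xs y :
  judged t (pcode c) (CodeSeq.code xs) y -> prf_eval c xs y.
Proof.
elim: t c xs y => [|t IHt] c xs y; first by rewrite /judged /recorded div0n.
have IH e l v c' xs' : judged t e l v -> e = pcode c' -> l = CodeSeq.code xs' ->
  prf_eval c' xs' v by move=> + eE lE; rewrite eE lE; exact: IHt.
rewrite judgedS => /andP[_]; rewrite /just -!/(judged t).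
case: c => [||i|f gs|f g|f]; cbn [pcode]; rewrite !nthL_code ?headL_code ?tailL_code /= ?orbF.
- by move/eqP->; constructor.
- by move/eqP->; constructor.
- by move/eqP->; constructor.
- case/bexP=> ysc _ /andP[/andP[Hf Hsz] /ballP Hgs].
  (* The witness is an arbitrary number, but every number codes a list of values. *)
  move: Hf Hsz Hgs; rewrite -(CodeSeq.decodeK ysc) !sizeL_code size_map => Hf /eqP Hsz Hgs.
  apply: ev_comp (IH _ _ _ _ _ Hf erefl erefl).
  apply/(Forall2_nth PZero 0); split=> // i; rewrite -Hsz => lt_i.
  have := Hgs i lt_i; rewrite !nthL_code (nth_map PZero) -?Hsz //; exact: IHt.
- case/orP.
    case/andP=> /eqP xsE H; move: xsE; rewrite consLE => /(can_inj CodeSeq.codeK) xsE.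
    by rewrite xsE; apply: ev_rec0; exact: IH H _ _.
  case/andP=> /eqP xsE /bexP[r _ /andP[Hr Hg]]; move: xsE Hr Hg.
  rewrite !consLE => /(can_inj CodeSeq.codeK) xsE Hr Hg.
  by rewrite xsE; apply: ev_recS (IH _ _ _ (PRec f g) _ Hr _ _) (IH _ _ _ _ _ Hg _ _).
- case/andP; rewrite consLE => /IHt H0 /ballP Hm.
  apply: ev_mu H0 _ => m /Hm/bexP[k _]; rewrite consLE => /IHt Hk.
  by exists k.+1.
Qed.

Definition accepts e k t : bool :=
  bex t (fun y => recorded (stage t) e (consL k 0) y).

Lemma cpred_accepts : cpred (fun r => accepts (r 0) (r 1) (r 2)).
Proof.
rewrite /accepts /recorded; cf; apply: (cfun_app1 cfun_stage); exact: cfun_var.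
Qed.

Lemma acceptsP c k :
  (exists t, accepts (pcode c) k t) <-> exists y, prf_eval c [:: k] y.
Proof.
rewrite /accepts -[0]/(CodeSeq.code [::]); split=> [[t] /bexP[y _]|[y]].
  by rewrite consLE => /judged_sound; exists y.
case/judged_complete=> t Ht; exists t; apply/bexP; exists y; last by rewrite consLE.
by case/and3P: (judged_lt Ht).
Qed.

Lemma accepts_mono e k t t' : t <= t' -> accepts e k t -> accepts e k t'.
Proof.
move=> le_tt' /bexP[y lt_y Hy]; apply/bexP; exists y; first exact: leq_trans le_tt'.
exact: judged_mono Hy.
Qed.

(** * The leftmost path outside a universal test *)

(** A number [v < 2 ^ t] stands for the string of length [t] with code [2 ^ t + v], and division by
    [2 ^ (t - n)] restricts it to [n] bits. The string is hit if by stage [t] program [e] has put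
    one of its prefixes into component [e+1]. *)
Definition hit e t v : bool := bex t.+1 (fun n =>
  accepts e (code_pair e.+1 (2 ^ n + v %/ 2 ^ (t - n))) t).

Definition thin e t : bool := bsum (2 ^ t) (hit e t) * 2 ^ e.+1 <= 2 ^ t.

(* Program [e] may enumerate only at stages where it still looks like a test of
   measure at most [2^-(e+1)]; past enumerations are kept, so badness is monotone. *)
Definition bad t v : bool := bex t.+1 (fun t' => bex t' (fun e =>
  thin e t' && hit e t' (v %/ 2 ^ (t - t')))).

(* The least [v] that is not bad: it is counted by the [v] with all [w <= v] bad. *)
Definition leftmost t : nat :=
  bsum (2 ^ t) (fun v => ball v.+1 (fun w => bad t w)).

Lemma cfun_code_pair : cfun (fun r => code_pair (r 0) (r 1)).
Proof.
apply: (cfun_ext (F := fun r => (2 ^ r 0 * (r 1 * 2).+1).-1)); last by cf.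
by move=> r; rewrite /code_pair muln2.
Qed.

Lemma cfun_leftmost : cfun (fun r => leftmost (r 0)).
Proof.
have chit : cpred (fun r => hit (r 0) (r 1) (r 2)).
  rewrite /hit; cf.
  apply: (cfun_app3 (f := fun e k t => nat_of_bool (accepts e k t)) cpred_accepts); cf.
  by apply: (cfun_app2 cfun_code_pair); cf.
have cthin : cpred (fun r => thin (r 0) (r 1)).
  by rewrite /thin; cf; apply: (cfun_app3 (f := fun e t v => nat_of_bool (hit e t v)) chit); cf.
have cbad : cpred (fun r => bad (r 0) (r 1)).
  rewrite /bad; cf; first by apply: (cfun_app2 (f := fun e t => nat_of_bool (thin e t)) cthin); cf.
  by apply: (cfun_app3 (f := fun e t v => nat_of_bool (hit e t v)) chit); cf.
by rewrite /leftmost; cf; apply: (cfun_app2 (f := fun t v => nat_of_bool (bad t v)) cbad); cf.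
Qed.

Lemma div2X_div v n m k : n <= m -> m <= k ->
  v %/ 2 ^ (k - m) %/ 2 ^ (m - n) = v %/ 2 ^ (k - n).
Proof.
move=> le_nm le_mk; rewrite -divnMA -expnD; congr (_ %/ 2 ^ _); lia.
Qed.

Lemma hit_mono e s t v : s <= t -> hit e s (v %/ 2 ^ (t - s)) -> hit e t v.
Proof.
move=> le_st /bexP[n]; rewrite ltnS => le_ns; rewrite div2X_div // => Hn.
apply/bexP; exists n; first by rewrite ltnS; exact: leq_trans le_st.
exact: accepts_mono Hn.
Qed.

Lemma bad_mono s t v : s <= t -> bad s (v %/ 2 ^ (t - s)) -> bad t v.
Proof.
move=> le_st /bexP[s' le_s's /bexP[e lt_es' /andP[th]]].
rewrite div2X_div // => h; apply/bexP; exists s'; first by lia.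
by apply/bexP; exists e; rewrite // th.
Qed.

Lemma leq_bsum n f g : (forall i, i < n -> f i <= g i) -> bsum n f <= bsum n g.
Proof. by move=> le_fg; apply: leq_sum => i _; exact: le_fg. Qed.

Lemma bsum_div n d (f : nat -> nat) : 0 < d ->
  bsum (n * d) (fun v => f (v %/ d)) = bsum n f * d.
Proof.
move=> d0; rewrite /bsum; elim: n => [|n IHn]; first by rewrite mul0n !big_ord0 mul0n.
rewrite mulSnr big_split_ord /= IHn big_ord_recr mulnDl; congr (_ + _).
rewrite (eq_bigr (fun=> f n)); first by rewrite sum_nat_const card_ord mulnC.
by move=> i _; rewrite /= divnMDl // divn_small ?addn0.
Qed.

(** Only the last thin stage matters: hits persist, so it already counts all earlier ones, and its
    own count is small by thinness. A stage that is not thin adds nothing. *)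
Lemma thin_hits_bound e t T : T <= t ->
  bsum (2 ^ t) (fun v => bex T.+1 (fun t' =>
    [&& e < t', thin e t' & hit e t' (v %/ 2 ^ (t - t'))])) * 2 ^ e.+1 <= 2 ^ t.
Proof.
elim: T => [|T IHT] le_Tt.
  rewrite (_ : bsum _ _ = 0) //; apply: big1 => v _.
  by apply/eqP; rewrite eqb0; apply/bexP => -[[|//] _].
have [/andP[lt_eT th] | nth] := boolP ((e < T.+1) && thin e T.+1); last first.
  apply: leq_trans (IHT (ltnW le_Tt)); rewrite leq_mul2r; apply/orP; right.
  apply: leq_bsum => v _.
  case: bexP => // -[t']; rewrite ltnS leq_eqVlt => /predU1P[->|lt_t'] H.
    by case/and3P: H => ? ? _; move: nth; apply: contraNT => _; apply/andP.
  by rewrite lt0b; apply/bexP; exists t'.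
have eq_exp : 2 ^ t = 2 ^ T.+1 * 2 ^ (t - T.+1) by rewrite -expnD subnKC.
rewrite eq_exp.
apply: leq_trans (_ : bsum (2 ^ T.+1 * 2 ^ (t - T.+1))
    (fun v => hit e T.+1 (v %/ 2 ^ (t - T.+1))) * 2 ^ e.+1 <= _).
  rewrite leq_mul2r; apply/orP; right; apply: leq_bsum => v _.
  case: bexP => // -[t']; rewrite ltnS => le_t' /and3P[_ _ h].
  by rewrite lt0b; apply: (hit_mono le_t'); rewrite div2X_div.
rewrite (bsum_div _ (fun v => hit e T.+1 v)) ?expn_gt0 // mulnAC leq_mul2r.
by apply/orP; right.
Qed.

Lemma sum_halving (c : nat -> nat) m B : 0 < B ->
  (forall e, e < m -> c e * 2 ^ e.+1 <= B) -> \sum_(e < m) c e < B.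
Proof.
(* The geometric bound [B (1 - 2^-m)] with denominators cleared, in which form the induction goes
   through. *)
move=> B0 le_c; suff: (\sum_(e < m) c e) * 2 ^ m + B <= B * 2 ^ m.
  have := expn_gt0 2 m; nia.
elim: m le_c => [|m IHm] le_c; first by rewrite big_ord0 mul0n muln1.
have {IHm} := IHm (fun e lt_em => le_c e (ltnW lt_em)).
have := le_c m (ltnSn m); rewrite big_ord_recr /= expnS.
have := expn_gt0 2 m; nia.
Qed.

(** Union bound over the programs [e < t], each spoiling at most a fraction [2^-(e+1)] of the
    strings. *)
Lemma bad_count t : bsum (2 ^ t) (fun v => bad t v) < 2 ^ t.
Proof.
pose c e := bsum (2 ^ t) (fun v => bex t.+1 (fun t' =>
  [&& e < t', thin e t' & hit e t' (v %/ 2 ^ (t - t'))])).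
have lt_c : \sum_(e < t) c e < 2 ^ t.
  by apply: sum_halving => [|e _]; [rewrite expn_gt0 | exact: thin_hits_bound].
apply: leq_ltn_trans lt_c.
rewrite /c /bsum exchange_big; apply: leq_sum => v _ /=. rewrite /bad.
case: bexP => // -[t' le_t't /bexP[e lt_et' /andP[th h]]].
have lt_et : e < t by apply: leq_trans lt_et' _.
rewrite (bigD1 (Ordinal lt_et)) //= addn_gt0 lt0b; apply/orP; left.
by apply/bexP; exists t'; rewrite // lt_et' th.
Qed.

Lemma leftmostP t :
  [/\ leftmost t < 2 ^ t, ~~ bad t (leftmost t) & forall w, w < leftmost t -> bad t w].
Proof.
have ex_good : exists w, (w < 2 ^ t) && ~~ bad t w.
  apply: contrapT => no_good; have := bad_count t; rewrite ltnNge => /negP; apply.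
  rewrite -[leqLHS](minn_idPr (leqnn _)) -bsum_ltn; apply: leq_bsum => v lt_v.
  by rewrite lt_v lt0b; apply: contrapT => /negP nb; apply: no_good; exists v; rewrite lt_v.
suff -> : leftmost t = ex_minn ex_good.
  case: ex_minnP => w /andP[lt_w nbad] minw; split=> // u lt_uw.
  apply: contraLR (lt_uw) => nb; rewrite -leqNgt; apply: minw.
  by rewrite nb andbT; exact: ltn_trans lt_uw lt_w.
case: ex_minnP => w /andP[lt_w nbad] minw.
rewrite -[RHS](minn_idPr (ltnW lt_w)) -bsum_ltn; apply: eq_bigr => -[v /= lt_v] _.
congr nat_of_bool; apply/ballP/idP => [allbad | lt_vw u le_uv].
  by rewrite ltnNge; apply: contra nbad => le_wv; exact: allbad.
apply: contraLR lt_vw => nb; rewrite -leqNgt.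
have le_uv' : u <= v by [].
by apply: leq_trans (minw u _) le_uv'; rewrite nb andbT; exact: leq_ltn_trans lt_v.
Qed.

Lemma leftmost_lt t : leftmost t < 2 ^ t.
Proof. by case: (leftmostP t). Qed.

(** Anything to the left of [leftmost s] is bad at stage [s], and badness passes to extensions at
    later stages. *)
Lemma leftmost_mono s t : s <= t -> leftmost s <= leftmost t %/ 2 ^ (t - s).
Proof.
move=> le_st; rewrite leqNgt; apply/negP => /(let: And3 _ _ H := leftmostP s in H _).
by move/(bad_mono le_st); apply/negP; case: (leftmostP t).
Qed.

Lemma nondecreasing_bounded_stabilizes n B (y : nat -> nat) :
  (forall s t, n <= s -> s <= t -> y s <= y t) -> (forall s, n <= s -> y s < B) ->
  exists2 N, n <= N & forall s, N <= s -> y s = y N.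
Proof.
move=> mono_y lt_yB; pose P v := `[< exists2 s, n <= s & y s = v >].
have exP : exists v, P v by exists (y n); apply/asboolP; exists n.
have ubP v : P v -> v <= B by case/asboolP=> s le_ns <-; exact/ltnW/lt_yB.
case: (ex_maxnP exP ubP) => v /asboolP[N le_nN yN] maxv; exists N => // s le_Ns.
apply/eqP; rewrite eqn_leq (mono_y N s) // andbT yN; apply: maxv; apply/asboolP.
by exists s => //; exact: leq_trans le_Ns.
Qed.

Lemma leftmost_limit : exists a : nat -> nat, forall n, exists2 N, n <= N &
  forall s, N <= s -> leftmost s %/ 2 ^ (s - n) = a n.
Proof.
suff /choice[a Ha] n : exists v, exists2 N, n <= N &
    forall s, N <= s -> leftmost s %/ 2 ^ (s - n) = v by exists a.
have [s t le_ns le_st|s le_ns|N le_nN limN] :=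
    @nondecreasing_bounded_stabilizes n (2 ^ n) (fun s => leftmost s %/ 2 ^ (s - n)).
- by rewrite -(div2X_div _ le_ns le_st) leq_div2r // leftmost_mono.
- by rewrite ltn_divLR ?expn_gt0 // -expnD subnKC // leftmost_lt.
- by exists (leftmost N %/ 2 ^ (N - n)), N.
Qed.

(** * Cylinders and the measure lambda *)

Lemma code_str_rcons s b : code_str (rcons s b) = (code_str s).*2 + b.
Proof. by rewrite /code_str foldl_rcons. Qed.

Lemma code_str_bounds s : 2 ^ size s <= code_str s < 2 ^ (size s).+1.
Proof.
elim/last_ind: s => // s b; rewrite code_str_rcons size_rcons !expnS; case: b => /=; lia.
Qed.

Lemma code_str_inj : injective code_str.
Proof.
have pos s : 0 < code_str s.
  by case/andP: (code_str_bounds s) => + _; apply: leq_trans; rewrite expn_gt0.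
have c0 : code_str [::] = 1 by [].
elim/last_ind=> [|s b IHs] s'; case: (lastP s') => [|{}s' b'] //.
- by rewrite code_str_rcons c0; have := pos s'; case: b' => /=; lia.
- by rewrite code_str_rcons c0; have := pos s; case: b => /=; lia.
- rewrite !code_str_rcons => eq_c; rewrite (IHs s'); last by case: b b' eq_c => [] [] /=; lia.
  by congr rcons; case: b b' eq_c => [] [] //=; lia.
Qed.

Lemma prefix_rconsr (T : eqType) (t s : seq T) x :
  prefix t (rcons s x) = (t == rcons s x) || prefix t s.
Proof.
elim: s t => [|y s IHs] [|z t] //=; first by rewrite eqseq_cons orbF; case: t.
by rewrite eqseq_cons IHs; case: (z == y).
Qed.

(** The measure of the intersection of two cylinders, which are nested or disjoint. *)
Definition overlap (s t : bstring) : \bar Rr :=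
  if prefix s t then weight t else if prefix t s then weight s else 0%E.

Lemma weight_ge0 s : (0 <= weight s)%E.
Proof. by rewrite /weight lee_fin invr_ge0 exprn_ge0. Qed.

Lemma weight_split s b b' :
  (weight s = weight (rcons s b) + weight (rcons s b'))%E.
Proof.
rewrite /weight !size_rcons -EFinD; congr (_%:E).
by rewrite GRing.exprS invfM -mulrDl -[X in (X + X)%R]div1r -splitr mul1r.
Qed.

Lemma overlap_ge0 s t : (0 <= overlap s t)%E.
Proof. by rewrite /overlap; case: ifP => _; [|case: ifP => _ //]; exact: weight_ge0. Qed.

Lemma overlap_split s t :
  (overlap s t = overlap (rcons s false) t + overlap (rcons s true) t)%E.
Proof.
have nb b : prefix (rcons s b) t -> prefix s t.
  exact: prefix_trans (prefix_rcons s b).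
rewrite /overlap !prefix_rconsr; case: (boolP (prefix s t)) => [/prefixP[u ->]|nst].
  case: u => [|b u].
    have nrc b : prefix (rcons s b) s = false.
      by apply/negP => /size_prefix; rewrite size_rcons ltnn.
    by rewrite cats0 prefix_refl !nrc !orbT; exact: weight_split.
  rewrite -!cats1 !prefix_catr // !eqseq_cat //= !eqxx /=.
  have -> : prefix (s ++ b :: u) s = false.
    by apply/negP => /size_prefix; rewrite size_cat /=; lia.
  by case: b; rewrite /= ?prefix0s ?add0e ?adde0.
have nc b : prefix (rcons s b) t = false by apply: contraNF nst; exact: nb.
have ne b : t == rcons s b = false.
  by apply: contraNF nst => /eqP->; exact: prefix_rcons.
by rewrite !nc !ne /=; case: ifP => _; [exact: weight_split | rewrite adde0].
Qed.

(** The share of the total weight of [S] that falls into the cylinder of [s]. Its additivity under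
    halving reduces the comparison of covers to strings of one length. *)
Definition mass (S : set bstring) (s : bstring) : \bar Rr :=
  (\esum_(t in S) overlap s t)%R.

Lemma mass_split S s :
  (mass S s = mass S (rcons s false) + mass S (rcons s true))%E.
Proof.
rewrite /mass -esumD; try by move=> *; exact: overlap_ge0.
by apply: eq_esum => t _; exact: overlap_split.
Qed.

Lemma mass_nil S : mass S [::] = (\esum_(t in S) weight t)%R.
Proof. by apply: eq_esum => t _; rewrite /overlap prefix0s. Qed.

Lemma sprefixE s X : sprefix s X <-> s = mkseq X (size s).
Proof.
split=> [sX | ->]; last by rewrite /sprefix size_mkseq => i lt_i; rewrite nth_mkseq.
by apply: (@eq_from_nth _ false) => [|i lt_i]; rewrite ?size_mkseq // nth_mkseq // sX.
Qed.

Lemma prefix_mkseq (X : cantor) m n : m <= n -> prefix (mkseq X m) (mkseq X n).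
Proof.
move=> /subnKC <-; elim: (n - m) => [|k IHk]; first by rewrite addn0 prefix_refl.
by rewrite addnS mkseqS; apply: prefix_trans IHk _; exact: prefix_rcons.
Qed.

(* Otherwise one half of the cylinder is also too light; halving forever
   leads to a point not covered by S. *)
Lemma mass_covered (S : set bstring) s :
  (cyl s `<=` \bigcup_(t in S) cyl t)%classic -> (weight s <= mass S s)%E.
Proof.
move=> covS; rewrite leNgt; apply/negP => light_s.
pose light t := (mass S t < weight t)%E.
have step t : light t -> exists b, light (rcons t b).
  move=> light_t; apply: contrapT => no_b; move: light_t; rewrite /light ltNge => /negP; apply.
  rewrite (weight_split t false true) mass_split leeD // leNgt; apply/negP => lt_b; apply: no_b.
    by exists false.
  by exists true.
pose next t := rcons t (if asbool (light (rcons t false)) then false else true).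
have light_next t : light t -> light (next t).
  move=> /step[b light_b]; rewrite /next; case: asboolP => // nf.
  by case: b light_b.
pose p n := iter n next s; have light_p n : light (p n) by elim: n => //= n; exact: light_next.
have size_p n : size (p n) = size s + n.
  by elim: n => [|n IHn] /=; rewrite ?addn0 // /next size_rcons -/(p n) IHn addnS.
have pre_p m n : m <= n -> prefix (p m) (p n).
  move=> /subnKC <-; elim: (n - m) => [|k IHk]; first by rewrite addn0 prefix_refl.
  by rewrite addnS; apply: prefix_trans IHk _; exact: prefix_rcons.
pose X : cantor := fun i => nth false (p i.+1) i.
have Xp n : sprefix (p n) X.
  move=> i lt_i; rewrite /X.
  have [/pre_p|/ltnW/pre_p] := leqP i.+1 n => /prefixP[u pE].
    by rewrite pE nth_cat size_p; case: ltnP => //; lia.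
  by rewrite pE nth_cat lt_i.
have [t St tX] := covS X (Xp 0).
have := light_p (size t); rewrite /light ltNge => /negP; apply.
have pre_t : prefix t (p (size t)).
  have /sprefixE tE := tX; have /sprefixE pE := Xp (size t).
  by rewrite [X in prefix X _]tE pE; apply: prefix_mkseq; rewrite size_p leq_addl.
(* The single string [t], a prefix of [p (size t)], already contributes the full weight of
   [p (size t)]. *)
apply: esum_ge; exists [set t]%classic; first by split => // u ->.
rewrite fsbig_set1 /overlap pre_t; case: ifP => // /size_prefix.
rewrite /weight => le_sz; have := size_prefix pre_t => le_sz'.
have eq_sz : size (p (size t)) = size t by apply/eqP; rewrite eqn_leq le_sz.
by rewrite eq_sz.
Qed.

Definition ext_count (P : nat -> bool) s k :=
  bsum (2 ^ k) (fun v => P (code_str s * 2 ^ k + v)).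

Lemma ext_countS P s k :
  ext_count P s k.+1 = ext_count P (rcons s false) k + ext_count P (rcons s true) k.
Proof.
rewrite /ext_count /bsum expnS mul2n -addnn big_split_ord /=.
congr (_ + _); apply: eq_bigr => i _; rewrite code_str_rcons /=; do 2 f_equal; lia.
Qed.

Definition strings_of n (P : nat -> bool) : set bstring :=
  [set s | size s = n /\ P (code_str s)]%classic.

Definition dyadic (c n : nat) : \bar Rr := (c%:R * (2%:R ^- n))%R%:E.

Lemma dyadicD c d n : (dyadic (c + d) n = dyadic c n + dyadic d n)%E.
Proof. by rewrite /dyadic natrD mulrDl EFinD. Qed.

(** Both bounds come from halving the space down to length [n]. From above the strings themselves
    are the cover; from below any cover has mass at least the weight of each selected string, by
    compactness in the form of [mass_covered]. *)
Lemma lambda_strings n P :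
  lambda (gen_open (strings_of n P)) = dyadic (bsum (2 ^ n) (fun v => P (2 ^ n + v))) n.
Proof.
have cntE : bsum (2 ^ n) (fun v => P (2 ^ n + v)) = ext_count P [::] n.
  by rewrite /ext_count mul1n.
have base0 P' s : ext_count P' s 0 = P' (code_str s).
  by rewrite /ext_count /bsum big_ord_recl big_ord0 !addn0 muln1.
apply/eqP; rewrite eq_le cntE; apply/andP; split.
  apply: le_trans (ereal_inf_lbound _) (_ : mass (strings_of n P) [::] <= _)%E.
    by exists (strings_of n P) => //; rewrite mass_nil.
  have: size (Nil bool) + n = n by [].
  elim: {1 4}n [::] => [|k IHk] s.
    rewrite addn0 base0 => sz_s.
    have -> : mass (strings_of n P) s = esum (strings_of n P `&` [set s])%classic weight.
      rewrite esum_mkcondr; apply: eq_esum => t [sz_t _]; rewrite /overlap.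
      case: ifPn => [|nst].
        move=> /prefixP[u tE]; have u0 : u = [::].
          by apply: size0nil; apply: (@addnI n); rewrite addn0 -{1}sz_s -size_cat -tE.
        by rewrite tE u0 cats0 mem_set.
      rewrite memNset; last by move=> ts; rewrite ts prefix_refl in nst.
      case: ifP => // /prefixP[u sE]; case/negP: nst.
      have u0 : u = [::] by apply: size0nil; apply: (@addnI n); rewrite addn0 -{1}sz_t -size_cat -sE.
      by rewrite sE u0 cats0 prefix_refl.
    case: (boolP (P _)) => Ps.
      rewrite (_ : (_ `&` _)%classic = [set s]%classic); last first.
        by apply/seteqP; split=> [t []|t ->].
      by rewrite esum_set1 ?weight_ge0 // /dyadic mul1r /weight sz_s.
    rewrite (_ : (_ `&` _)%classic = set0); last first.
      by apply/seteqP; split=> // t [[_ Pt] ts]; rewrite ts (negbTE Ps) in Pt.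
    by rewrite esum_set0 /dyadic mul0r.
  rewrite addnS -addSn => sz_s; rewrite mass_split ext_countS dyadicD.
  by apply: leeD; apply: IHk; rewrite size_rcons.
apply/ereal_infP => _ [S covS <-]; rewrite -mass_nil.
have: size (Nil bool) + n = n by [].
elim: {1 3}n [::] => [|k IHk] s.
  rewrite addn0 base0 => sz_s; case: (boolP (P _)) => Ps; last first.
    rewrite /dyadic mul0r; apply: esum_ge0 => t _; exact: overlap_ge0.
  rewrite /dyadic mul1r -sz_s; apply: mass_covered => X sX; apply: covS.
  by exists s.
rewrite addnS -addSn => sz_s; rewrite mass_split ext_countS dyadicD.
by apply: leeD; apply: IHk; rewrite size_rcons.
Qed.

(** * Randomness of the leftmost path *)

(** Up to a shift by one the pairing is a list code, from which it inherits injectivity. *)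
Lemma code_pairE n m : (code_pair n m).+1 = CodeSeq.code (n :: CodeSeq.decode m).
Proof.
rewrite -consLE CodeSeq.decodeK /consL muln2 /code_pair prednK //.
by rewrite muln_gt0 expn_gt0.
Qed.

Lemma code_pair_inj n m n' m' : code_pair n m = code_pair n' m' -> n = n' /\ m = m'.
Proof.
move=> /(congr1 succn); rewrite !code_pairE => /(can_inj CodeSeq.codeK)[-> eqm].
by split=> //; exact: (can_inj CodeSeq.decodeK).
Qed.

Lemma code_str_take n s : n <= size s ->
  code_str (take n s) = code_str s %/ 2 ^ (size s - n).
Proof.
elim/last_ind: s => [|s b IHs]; first by rewrite leqn0 => /eqP->; rewrite divn1.
rewrite size_rcons leq_eqVlt ltnS => /predU1P[->|le_ns].
  by rewrite subnn divn1 take_oversize // size_rcons.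
rewrite -cats1 takel_cat // IHs // cats1 code_str_rcons subSn // expnS divnMA.
by congr (_ %/ _); case: b => /=; lia.
Qed.

Lemma code_str_surj n c : 2 ^ n <= c < 2 ^ n.+1 ->
  exists2 s, size s = n & code_str s = c.
Proof.
elim: n c => [|n IHn] c; first by exists [::] => //; rewrite /code_str /=; lia.
rewrite expnS [2 ^ n.+2]expnS => bnd.
have [|s sz_s cs] := IHn c./2; first by lia.
exists (rcons s (odd c)); first by rewrite size_rcons sz_s.
by rewrite code_str_rcons cs addnC odd_double_half.
Qed.

Lemma code_str_nseq n : code_str (nseq n false) = 2 ^ n.
Proof.
elim: n => // n IHn; rewrite expnS -IHn -[n.+1]addn1 nseqD cats1 code_str_rcons.
by rewrite addn0 mul2n.
Qed.

Lemma sprefix_take n s X : sprefix s X -> sprefix (take n s) X.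
Proof.
move=> sX i; rewrite size_take_min leq_min => /andP[lt_in lt_is].
by rewrite nth_take // sX.
Qed.

Lemma lambda_le A B : (A `<=` B)%classic -> (lambda A <= lambda B)%E.
Proof.
move=> AB; apply/ereal_infP => _ [S covS <-]; apply: ereal_inf_lbound.
by exists S => //; exact: subset_trans covS.
Qed.

(** A genuine test is never cut off: the strings hit at stage [t] generate a subset of component
    [e+1], so their proportion is at most [2^-(e+1)]. *)
Lemma ML_test_thin U c : ML_test U ->
  (forall k, [set k | exists n s, U (n, s) /\ k = code_pair n (code_str s)]%classic k
     <-> exists y, prf_eval c [:: k] y) ->
  forall t, thin (pcode c) t.
Proof.
move=> [_ small] Uc t; set e := pcode c.
pose P k := hit e t (k - 2 ^ t).
have sub : (gen_open (strings_of t P) `<=`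
    gen_open [set s | U (e.+1, s)])%classic.
  move=> X [s [sz_s /bexP[n]]]; rewrite ltnS => le_nt acc sX.
  have /acceptsP/Uc[n' [s' [Us']]] := ex_intro (accepts _ _) t acc.
  have cE : 2 ^ n + (code_str s - 2 ^ t) %/ 2 ^ (t - n) = code_str (take n s).
    have /andP[lo _] := code_str_bounds s; rewrite sz_s in lo.
    rewrite code_str_take sz_s //; set r := code_str s - 2 ^ t.
    have -> : code_str s = 2 ^ n * 2 ^ (t - n) + r by rewrite -expnD !subnKC.
    by rewrite divnMDl // expn_gt0.
  rewrite cE => /code_pair_inj[n'E /code_str_inj s'E]; rewrite -n'E -s'E in Us'.
  by exists (take n s) => //; exact: sprefix_take.
have := le_trans (lambda_le sub) (small e.+1).
rewrite lambda_strings /dyadic lee_fin ler_pdivrMr ?exprn_gt0 //.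
rewrite mulrC ler_pdivlMr ?exprn_gt0 // -!natrX -natrM ler_nat.
rewrite /thin (_ : bsum _ _ = bsum (2 ^ t) (hit e t)) //.
by apply: eq_bigr => i _; rewrite /P addKn.
Qed.

Definition leftmost_limit_path (a : nat -> nat) := forall n, exists2 N, n <= N &
  forall s, N <= s -> leftmost s %/ 2 ^ (s - n) = a n.

Lemma path_div a (aP : leftmost_limit_path a) n m : n <= m -> a m %/ 2 ^ (m - n) = a n.
Proof.
move=> le_nm; have [N le_nN HN] := aP n; have [M le_mM HM] := aP m.
rewrite -(HN (maxn N M)) ?leq_maxl // -(HM (maxn N M)) ?leq_maxr //.
by rewrite div2X_div //; lia.
Qed.

Lemma path_lt a (aP : leftmost_limit_path a) n : a n < 2 ^ n.
Proof.
have [N le_nN /(_ N (leqnn N)) <-] := aP n.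
by rewrite ltn_divLR ?expn_gt0 // -expnD subnKC // leftmost_lt.
Qed.

Lemma leftmost_le_path a (aP : leftmost_limit_path a) w n : n <= w -> leftmost w %/ 2 ^ (w - n) <= a n.
Proof.
move=> le_nw; have [N le_nN HN] := aP n.
rewrite -(HN (maxn N w)) ?leq_maxl // -(@div2X_div (leftmost (maxn N w)) n w) ?leq_maxr //.
by rewrite leq_div2r // leftmost_mono // leq_maxr.
Qed.

(** The enumerable access to [a]: its values are only limits, but being at most [a n] is confirmed
    at a finite stage. *)
Lemma le_path a (aP : leftmost_limit_path a) z n :
  (exists w, (n <= w) && (z <= leftmost w %/ 2 ^ (w - n))) <-> z <= a n.
Proof.
split=> [[w /andP[le_nw le_z]] | le_za].
  exact: leq_trans le_z (leftmost_le_path aP le_nw).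
by have [N le_nN HN] := aP n; exists N; rewrite le_nN HN.
Qed.

Lemma leftmost_le_path0 a (aP : leftmost_limit_path a) n : leftmost n <= a n.
Proof. by have := leftmost_le_path aP (leqnn n); rewrite subnn divn1. Qed.

Definition leftmost_path (a : nat -> nat) : cantor := fun i => odd (a i.+1).

Lemma code_str_path a (aP : leftmost_limit_path a) n : code_str (mkseq (leftmost_path a) n) = 2 ^ n + a n.
Proof.
elim: n => [|n IHn]; first by have := path_lt aP 0; rewrite /code_str; case: (a 0).
rewrite mkseqS code_str_rcons IHn -(path_div aP (leqnSn n)) subSnn expn1 divn2.
rewrite /leftmost_path expnS; have := odd_double_half (a n.+1); lia.
Qed.

(** A test capturing the path would enumerate one of its prefixes into component [e+1], where [e]
    codes a program for the test; late approximations extend that prefix and would be bad. *)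
Lemma leftmost_path_MLR a (aP : leftmost_limit_path a) : MLR (leftmost_path a).
Proof.
move=> U testU inU; have [[c Uc] _] := testU; set e := pcode c.
have [s Us sX] := inU e.+1.
have /Uc/acceptsP[t acc] : [set k | exists n s, U (n, s) /\ k = code_pair n (code_str s)]%classic
    (code_pair e.+1 (code_str s)) by exists e.+1, s.
have [N le_N HN] := aP (size s).
(* Late enough for the enumeration of [s], for the first [size s] bits to have settled, and for
   program [e] to be considered. *)
pose T := maxn t (maxn N e.+1).
have [_ /negP good _] := leftmostP T; apply: good.
apply/bexP; exists T => //; apply/bexP; exists e; first by rewrite /T; lia.
rewrite subnn divn1 (ML_test_thin testU Uc) /=; apply/bexP.
exists (size s); first by rewrite /T; lia.
rewrite HN; last by rewrite /T; lia.
move/sprefixE: (sX) acc => {1}->; rewrite (code_str_path aP) => acc.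
by apply: accepts_mono acc; exact: leq_maxl.
Qed.

(** * The two functionals *)

Lemma ce_nat_eq (A B : set nat) : (forall k, A k <-> B k) -> ce_nat A -> ce_nat B.
Proof. by move=> eqAB [c Ac]; exists c => k; rewrite -eqAB. Qed.

Lemma zero_not_MLR : ~ MLR (fun=> false).
Proof.
pose U : set (nat * bstring) := [set p | p.2 = nseq p.1 false]%classic.
move=> /(_ U); apply.
  split=> [|n].
    have cR : cpred (fun r => r 1 == code_pair (r 0) (2 ^ r 0)).
      by cf; apply: (cfun_app2 cfun_code_pair); cf.
    apply: ce_nat_eq (ce_nat_ex (R := fun w k => k == code_pair w (2 ^ w)) cR) => k.
    split=> [[w /eqP->] | [n [s [+ ->]]]].
      by exists w, (nseq w false); rewrite code_str_nseq.
    by rewrite /U /= => ->; exists n; rewrite code_str_nseq.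
  apply: le_trans (ereal_inf_lbound _) (_ : weight (nseq n false) <= _)%E.
    exists [set s | U (n, s)]%classic => //.
    by rewrite (_ : [set s | _]%classic = [set nseq n false]%classic) ?esum_set1 ?weight_ge0.
  by rewrite /weight size_nseq.
move=> n; exists (nseq n false) => // i; rewrite size_nseq => lt_in.
by rewrite nth_nseq lt_in.
Qed.

Lemma comparable_nseq m n : Defs.comparable (nseq m false) (nseq n false).
Proof.
rewrite /Defs.comparable; have [|/ltnW] := leqP m n => /subnKC <-.
  by rewrite nseqD prefix_prefix.
by rewrite nseqD prefix_prefix orbT.
Qed.

(** Strings of zeros are always comparable, so every enumerable choice of accepted strings gives a
    Turing functional. *)
Definition zero_functional (P : nat -> nat -> bool) : set (bstring * bstring) :=
  [set p | p.2 = nseq (size p.1) false /\ P (size p.1) (code_str p.1)]%classic.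

Lemma zero_functional_turing (P : nat -> nat -> bool) (Q : nat -> nat -> nat -> bool) :
  cpred (fun r => Q (r 0) (r 1) (r 2)) ->
  (forall n c, (exists w, Q n w c) <-> P n c) ->
  turing_functional (zero_functional P).
Proof.
move=> cQ QP; split; last first.
  by move=> s t s' t' [/= -> _] [/= -> _] _; exact: comparable_nseq.
(* One unbounded [W] covers the length [n], the witness [w] and the code [c]. The codes of strings
   of length [n] fill the range from [2 ^ n] to [2 ^ n.+1 - 1], and [2 ^ n] codes the output. *)
pose R W k := bex W (fun n => bex W (fun w => bex W (fun c =>
  ((2 ^ n <= c) && (c.+1 <= 2 ^ n.+1)) && ((k == code_pair c (2 ^ n)) && Q n w c)))).
have cR : cpred (fun r => R (r 0) (r 1)).
  rewrite /R; cf; first by apply: (cfun_app2 cfun_code_pair); cf.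
  by apply: (cfun_app3 (f := fun n w c => nat_of_bool (Q n w c)) cQ); cf.
apply: ce_nat_eq (ce_nat_ex cR) => k; split.
  case=> W /bexP[n _ /bexP[w _ /bexP[c _ /andP[bnd /andP[/eqP-> Qc]]]]].
  have [s sz_s cs] := code_str_surj bnd.
  exists s, (nseq n false); rewrite code_str_nseq cs; split=> //; split; rewrite /= sz_s ?cs //.
  by apply/QP; exists w.
case=> s [t [[/= -> /QP[w Qw]] ->]]; pose n := size s; pose c := code_str s.
exists (n + w + c).+1; apply/bexP; exists n; first by lia.
apply/bexP; exists w; first by lia.
apply/bexP; exists c; first by lia.
by rewrite code_str_nseq eqxx Qw !andbT; exact: code_str_bounds.
Qed.

(** By nestedness, longer accepted strings lie in cylinders already accepted at length [size u], so
    that length alone determines the measure. An output never extends a string containing a one. *)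
Lemma lambda_zero_functional (P : nat -> nat -> bool) u :
  (forall n m c, n <= m -> 2 ^ m <= c < 2 ^ m.+1 -> P m c -> P n (c %/ 2 ^ (m - n))) ->
  lambda_F (zero_functional P) u =
  if u == nseq (size u) false
  then dyadic (bsum (2 ^ size u) (fun v => P (size u) (2 ^ size u + v))) (size u)
  else lambda set0.
Proof.
move=> nested; rewrite /lambda_F; case: eqP => [uE | u_nz].
  rewrite -lambda_strings; congr lambda; apply/seteqP; split=> X /=.
    case=> s [t [[/= tE Ps] [sX /size_prefix le_us]]].
    rewrite tE size_nseq in le_us; exists (take (size u) s); last exact: sprefix_take.
    split; first by rewrite size_takel.
    by rewrite code_str_take //; apply: nested => //; exact: code_str_bounds.
  case=> s [sz_s Ps] sX; exists s, (nseq (size s) false); split=> /=.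
    by split=> //=; rewrite sz_s.
  by rewrite sz_s -uE prefix_refl.
congr lambda; apply/seteqP; split=> // X /= [s [t [[/= tE _] [_ /prefixP[v tuv]]]]].
case: u_nz; apply/all_pred1P; have : all (pred1 false) t by rewrite tE all_nseq /= orbT.
by rewrite tuv all_cat => /andP[].
Qed.

Lemma bsum_interval n x y : x <= y -> y < n ->
  bsum n (fun v => x <= v <= y) = bsum n (fun v => v + x <= y).
Proof.
move=> le_xy lt_yn.
have -> : bsum n (fun v => v + x <= y) = y.+1 - x.
  rewrite -[RHS](minn_idPr (_ : _ <= n)); last by lia.
  rewrite -bsum_ltn; apply: eq_bigr => v _; congr nat_of_bool; lia.
suff <- : bsum n (fun v => v < x) + bsum n (fun v => x <= v <= y) = y.+1.
  rewrite bsum_ltn; lia.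
rewrite -[RHS](minn_idPr lt_yn) -bsum_ltn /bsum -big_split; apply: eq_bigr => v _ /=.
by rewrite ltnS; case: ltnP; case: leqP => //=; lia.
Qed.

Theorem theorem4p1 :
  exists Phi Psi : set (bstring * bstring),
    turing_functional Phi /\ turing_functional Psi /\
    (forall u : bstring, lambda_F Phi u = lambda_F Psi u) /\
    fimage Phi MLR <> fimage Psi MLR.
Proof.
have [a aP] := leftmost_limit; rewrite -/(leftmost_limit_path a) in aP.
pose P n c := 2 ^ n + leftmost n <= c <= 2 ^ n + a n.
(* The interval of [P] translated by [leftmost n], written without truncated subtraction; its left
   end is the least code [2 ^ n] of a string of length [n]. *)
pose P' n c := c + leftmost n <= 2 ^ n + a n.
have lim0 := leftmost_le_path0 aP.
have tP : turing_functional (zero_functional P).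
  apply: (@zero_functional_turing P (fun n w c => (n <= w) &&
    ((2 ^ n + leftmost n <= c) && (c <= 2 ^ n + leftmost w %/ 2 ^ (w - n))))).
    by cf; apply: (cfun_app1 cfun_leftmost); cf.
  move=> n c; split=> [[w /andP[le_nw /andP[lo hi]]] | /andP[lo hi]].
    rewrite /P lo; apply: leq_trans hi _; rewrite leq_add2l; exact: leftmost_le_path.
  have /(le_path aP)[w /andP[le_nw Hw]] : c - 2 ^ n <= a n by lia.
  by exists w; rewrite le_nw lo /=; lia.
have tP' : turing_functional (zero_functional P').
  apply: (@zero_functional_turing P' (fun n w c => (n <= w) &&
    (c + leftmost n <= 2 ^ n + leftmost w %/ 2 ^ (w - n)))).
    by cf; apply: (cfun_app1 cfun_leftmost); cf.
  move=> n c; split=> [[w /andP[le_nw hi]] | hi].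
    apply: leq_trans hi _; rewrite leq_add2l; exact: leftmost_le_path.
  rewrite /P' in hi.
  have /(le_path aP)[w /andP[le_nw Hw]] : c + leftmost n - 2 ^ n <= a n by lia.
  by exists w; rewrite le_nw; lia.
have div_shift n m z : n <= m -> (2 ^ m + z) %/ 2 ^ (m - n) = 2 ^ n + z %/ 2 ^ (m - n).
  by move=> le_nm; rewrite -{1}(subnKC le_nm) expnD divnMDl // expn_gt0.
exists (zero_functional P), (zero_functional P'); split=> //; split=> //; split.
  move=> u; rewrite !lambda_zero_functional.
  - case: ifP => // _; congr dyadic; set n := size u.
    transitivity (bsum (2 ^ n) (fun v => leftmost n <= v <= a n)).
      by apply: eq_bigr => v _; rewrite /P !leq_add2l.
    rewrite bsum_interval ?path_lt //; apply: eq_bigr => v _.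
    by rewrite /P' -addnA leq_add2l.
  (* Nestedness of [P']: rounding down is superadditive, and [leftmost n] is at most the restriction
     of [leftmost m]. *)
  - move=> n m c le_nm _; rewrite /P' => hi.
    rewrite -(path_div aP le_nm) -div_shift //.
    apply: leq_trans (leq_div2r _ hi); rewrite leq_divRL ?expn_gt0 // mulnDl.
    apply: leq_add; first exact: leq_trunc_div.
    by rewrite -leq_divRL ?expn_gt0 // leftmost_mono.
  (* Nestedness of [P]: the right ends restrict to each other exactly, and the left ends only move
     right. *)
  move=> n m c le_nm _ /andP[lo hi]; rewrite /P -(path_div aP le_nm) -!div_shift //.
  rewrite leq_div2r // andbT; apply: leq_trans (leq_div2r _ lo).
  by rewrite div_shift // leq_add2l leftmost_mono.
have im0 : fimage (zero_functional P) MLR (fun=> false).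
  exists (leftmost_path a); split; first exact: leftmost_path_MLR.
  split=> [n|s t [/= -> _] _ i]; last first.
    by rewrite size_nseq => lt_i; rewrite nth_nseq lt_i.
  exists (mkseq (leftmost_path a) n), (nseq n false); split; last first.
    by split; [apply/sprefixE; rewrite size_mkseq | rewrite size_nseq].
  by split; rewrite /= size_mkseq // (code_str_path aP) /P leq_add2l lim0 /=.
move=> eq_im; rewrite eq_im in im0; have [Z [ZR [Zdom _]]] := im0.
apply: zero_not_MLR; suff <- : Z = fun=> false by [].
apply: funext => i; pose n := i.+1; have [N le_nN HN] := aP n.
have [s [t [[/= -> Ps] [sZ]]]] := Zdom N; rewrite size_nseq => le_Ns.
have le_ns := leq_trans le_nN le_Ns.
(* Beyond length [N] the approximation and the path agree on [n] bits, so at length [size s] they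
   differ by less than [2 ^ (size s - n)]; [P'] then leaves [s] no one among its first [n] bits. *)
have take0 : take n s = nseq n false.
  apply: code_str_inj; rewrite code_str_take // code_str_nseq.
  have /andP[lo _] := code_str_bounds s.
  have d0 : 0 < 2 ^ (size s - n) by rewrite expn_gt0.
  rewrite -(subnKC lo) div_shift // divn_small ?addn0 //.
  have := HN _ le_Ns; rewrite -(path_div aP le_ns) => eq_div.
  rewrite /P' in Ps.
  have := divn_eq (leftmost (size s)) (2 ^ (size s - n)).
  have := divn_eq (a (size s)) (2 ^ (size s - n)).
  have := ltn_pmod (a (size s)) d0.
  rewrite -eq_div; lia.
have := sprefix_take (n := n) sZ; rewrite take0 => /(_ i); rewrite size_nseq nth_nseq ltnSn.
by move=> <-.
Qed.
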